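(* Let $\mathcal{G}=(\mathcal{N},(\Omega^p)_{p\in\mathcal{N}},(\mathcal{U}^p)_{p\in\mathcal{N}})$ be a concave game with pseudo-gradient $U$, and suppose that for every $p\in\mathcal{N}$, $\mathcal{U}^p$ satisfies the following when $\Omega^p$ is non-compact: $-\mathcal{U}^p$ is coercive in $x^p$, i.e. $\lim_{\|x^p\|\to\infty}-\mathcal{U}^p(x^p;x^{-p})=+\infty$ for all $x^{-p}\in\Omega^{-p}$. For each $p\in\mathcal{N}$ let $\vartheta^p:\mathbb{R}^{n_p}\to\mathbb{R}\cup\{\infty\}$ be a closed, proper, convex function with $\operatorname{dom}(\vartheta^p)=\Omega^p$ non-empty, closed and convex, and suppose that $\vartheta^p$ is $\rho$-strongly convex ($\rho>0$). Let $\epsilon>0$, $\gamma>0$, and let $C=(C^p)_{p\in\mathcal{N}}$ be the mirror map induced by $\psi^p=\epsilon\vartheta^p$, $p\in\mathcal N$. Let the players' dynamics be the discounted mirror descent dynamics (DMD) $$\dot z^p=\gamma(-z^p+u^p),\qquad x^p=C^p(z^p),\qquad u^p=\nabla_{x^p}\mathcal{U}^p(x^p;x^{-p}),\qquad p\in\mathcal{N}.$$ Assume that $U\circ C$ has a finite number of fixed points $\overline z$, all isolated. (1) If $-U$ is monotone, or strictly monotone, or $\eta$-strongly monotone for some $\eta>0$, then for any $\epsilon>0$ the auxiliary variables $z(t)=(z^p(t))_{p\in\mathcal{N}}$ converge, as $t\to\infty$, to a rest point $\overline z$ of the dynamics, while the players' actions $x(t)=(x^p(t))_{p\in\mathcal{N}}$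 converge to $\overline x=C(\overline z)$, a perturbed Nash equilibrium of $\mathcal{G}$. (2) Alternatively, if $-U$ is $\mu$-hypo-monotone for some $\mu>0$, then the same conclusions hold for any $\epsilon>\mu\rho^{-1}$.
   Context: A game $\mathcal{G}=(\mathcal{N},(\Omega^p)_{p\in\mathcal N},(\mathcal{U}^p)_{p\in\mathcal N})$ has player set $\mathcal{N}=\{1,\dots,N\}$, action sets $\Omega^p\subseteq\mathbb{R}^{n_p}$, $\Omega=\prod_p\Omega^p\subseteq\mathbb{R}^n$, $n=\sum_p n_p$, and payoff functions $\mathcal{U}^p:\Omega\to\mathbb{R}$. One writes $x=(x^p;x^{-p})$, where $x^{-p}\in\Omega^{-p}$ is the action profile of all players except $p$. $\mathcal{G}$ is a concave game if for all $p$: $\Omega^p$ is non-empty, closed and convex; $\mathcal{U}^p$ is jointly continuous in $x$; and $\mathcal{U}^p(x^p;x^{-p})$ is concave and continuously differentiable in $x^p$ for all $x^{-p}\in\Omega^{-p}$. The pseudo-gradient is $U:\Omega\to\mathbb{R}^n$, $U(x)=(U^p(x))_{p\in\mathcal N}$, $U^p(x)=\nabla_{x^p}\mathcal{U}^p(x^p;x^{-p})$; it is taken to be continuous. For all $x,x'\in\Omega$: $-U$ is monotone if $-(U(x)-U(x'))^\top(x-x')\ge 0$; strictly monotone if this is $>0$ whenever $x\neq x'$; $\eta$-strongly monotone if it is $\ge\eta\|x-x'\|_2^2$; $\mu$-hypo-monotone if it is $\ge-\mu\|x-x'\|_2^2$. The mirror map $C^p:\mathbb{R}^{n_p}\to\Omega^p$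 induced by $\psi^p=\epsilon\vartheta^p$ is $C^p(z^p)=\operatorname{argmax}_{y^p\in\Omega^p}\left[{y^p}^\top z^p-\epsilon\vartheta^p(y^p)\right]$, and $C(z)=(C^p(z^p))_{p\in\mathcal N}$. Strong convexity is with respect to the Euclidean norm. A rest point of DMD is a point $\overline z\in\mathbb{R}^n$ with $\overline z=U(C(\overline z))$. A perturbed Nash equilibrium of $\mathcal{G}$ is a profile $\overline x\in\Omega$ that is a Nash equilibrium for the perturbed payoffs $\widetilde{\mathcal{U}}^p(x^p;x^{-p})=\mathcal{U}^p(x^p;x^{-p})-\epsilon\vartheta^p(x^p)$, i.e. $\widetilde{\mathcal{U}}^p(\overline x^p;\overline x^{-p})\ge\widetilde{\mathcal{U}}^p(x^p;\overline x^{-p})$ for all $x^p\in\Omega^p$, $p\in\mathcal{N}$. *)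

(* Defs.v *)
From HB Require Import structures.
From mathcomp Require Import all_boot all_order all_algebra.
From mathcomp Require Import all_classical all_reals all_analysis.

Set Implicit Arguments.
Unset Strict Implicit.
Unset Printing Implicit Defensive.

Import Order.TTheory GRing.Theory Num.Theory.
Import numFieldNormedType.Exports.

Local Open Scope classical_set_scope.
Local Open Scope ring_scope.

Section Euclidean.
Context {R : realType} {m : nat}.
Implicit Types (x y g z : 'rV[R]_m) (A : set 'rV[R]_m).

Definition dot x y : R := \sum_i x 0 i * y 0 i.

(* The library norm on row vectors is the sup norm; it is only used through
   the topology, which is the Euclidean one. *)
Definition norm2 x : R := Num.sqrt (dot x x).

Definition concave_function A (f : 'rV[R]_m -> R) : Prop :=
  convex_function A (fun x => - f x).

(* First-order expansion of f along A.  At an interior point of A, g is the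
   gradient of f at x; at a boundary point the expansion is one-sided, so that
   no value of f outside A is involved.  If A has empty interior, g is
   determined only up to a normal to the affine hull of A. *)
Definition has_gradient_within A (f : 'rV[R]_m -> R) x g : Prop :=
  (f y - f x - dot g (y - x)) / norm2 (y - x) @[y --> within A x^'] --> (0 : R).

Definition C1_within A (f : 'rV[R]_m -> R) : Prop :=
  exists g : 'rV[R]_m -> 'rV[R]_m,
    (forall x, A x -> has_gradient_within A f x (g x)) /\
    {within A, continuous g}.

Implicit Type theta : 'rV[R]_m -> \bar R.

Definition edom theta : set 'rV[R]_m := [set x | (theta x < +oo)%E].

Definition epigraph theta : set ('rV[R]_m * R) :=
  [set xr | (theta xr.1 <= xr.2%:E)%E].

Definition closed_function theta : Prop := closed (epigraph theta).

Definition proper_function theta : Prop :=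
  (forall x, (-oo < theta x)%E) /\ edom theta !=set0.

Definition strongly_convex (rho : R) theta : Prop :=
  forall (x y : 'rV[R]_m) (t : R), 0 <= t <= 1 ->
    (theta (t *: x + (1 - t) *: y)%R
     <= t%:E * theta x + (1 - t)%:E * theta y
        - (rho / 2 * t * (1 - t) * norm2 (x - y) ^+ 2)%:E)%E.

Definition econvex theta : Prop :=
  forall (x y : 'rV[R]_m) (t : R), 0 <= t <= 1 ->
    (theta (t *: x + (1 - t) *: y)%R
     <= t%:E * theta x + (1 - t)%:E * theta y)%E.

Definition argmax A (f : 'rV[R]_m -> \bar R) : set 'rV[R]_m :=
  [set y | A y /\ forall y', A y' -> (f y' <= f y)%E].

(* The default value 0 is used only if the maximum is not attained. *)
Definition mirror_map A (psi : 'rV[R]_m -> \bar R) z : 'rV[R]_m :=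
  xget 0 (argmax A (fun y => (dot y z)%:E - psi y)%E).

Definition monotone_on A (F : 'rV[R]_m -> 'rV[R]_m) : Prop :=
  forall x x', A x -> A x' -> 0 <= dot (F x - F x') (x - x').

Definition strictly_monotone_on A (F : 'rV[R]_m -> 'rV[R]_m) : Prop :=
  forall x x', A x -> A x' -> x <> x' -> 0 < dot (F x - F x') (x - x').

Definition strongly_monotone_on A (eta : R) (F : 'rV[R]_m -> 'rV[R]_m) : Prop :=
  forall x x', A x -> A x' ->
    eta * norm2 (x - x') ^+ 2 <= dot (F x - F x') (x - x').

Definition hypo_monotone_on A (mu : R) (F : 'rV[R]_m -> 'rV[R]_m) : Prop :=
  forall x x', A x -> A x' ->
    - mu * norm2 (x - x') ^+ 2 <= dot (F x - F x') (x - x').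

End Euclidean.

Section Game.
Context {R : realType} {N : nat} {n_ : 'I_N -> nat}.

Local Notation "''V'" := 'rV[R]_(\sum_p n_ p) (at level 0).
Local Notation "x `^p p" := (submxrow x p) (at level 8, p at level 2).

(* Payoffs are functions on the whole of R^n, but only their values at action
   profiles are ever used. *)
Record game := Game {
  actions : forall p, set 'rV[R]_(n_ p);
  payoff : 'I_N -> 'V -> R
}.
Arguments actions _ p _ : clear implicits.
Implicit Types (G : game) (x z : 'V).

(* (y; x^{-p}) *)
Definition deviate x (p : 'I_N) (y : 'rV[R]_(n_ p)) : 'V :=
  mxrow (dfwith (fun q => x `^p q) p y).

Definition profiles G : set 'V := [set x | forall p, actions G p (x `^p p)].

(* x^{-p} is an action profile of the players other than p; the p-th block of x
   is unconstrained. *)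
Definition opponents_feasible G (p : 'I_N) x : Prop :=
  forall q, q != p -> actions G q (x `^p q).

Definition concave_game G : Prop := forall p : 'I_N,
  [/\ actions G p !=set0, closed (actions G p) & convex_set (actions G p)] /\
  {within profiles G, continuous (payoff G p)} /\
  (forall x, opponents_feasible G p x ->
     concave_function (actions G p) (fun y => payoff G p (deviate x y)) /\
     C1_within (actions G p) (fun y => payoff G p (deviate x y))).

Definition pseudo_gradient G (U : 'V -> 'V) : Prop :=
  forall x p, profiles G x ->
    has_gradient_within (actions G p) (fun y => payoff G p (deviate x y))
      (x `^p p) ((U x) `^p p).

(* Limits at infinity are taken within the action set, where the payoff is
   defined. *)
Definition coercive_payoff G (p : 'I_N) : Prop :=
  forall x, opponents_feasible G p x ->
  forall M : R, exists K : R, forall y, actions G p y -> K < norm2 y ->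
    M < - payoff G p (deviate x y).

Definition nash_equilibrium (Om : forall p, set 'rV[R]_(n_ p))
    (V : 'I_N -> 'V -> \bar R) x : Prop :=
  (forall p, Om p (x `^p p)) /\
  forall p y, Om p y -> (V p (deviate x y) <= V p x)%E.

Section Regularized.
Variables (eps : R) (theta : forall p, 'rV[R]_(n_ p) -> \bar R).

Definition psi p (y : 'rV[R]_(n_ p)) : \bar R := (eps%:E * theta y)%E.

Definition perturbed_payoff G p x : \bar R :=
  ((payoff G p x)%:E - psi (x `^p p))%E.

Definition perturbed_nash G x : Prop :=
  nash_equilibrium (actions G) (perturbed_payoff G) x.

Definition Cmap G z : 'V :=
  \mxrow_p mirror_map (actions G p) (@psi p) (z `^p p).

Definition rest_points G (U : 'V -> 'V) : set 'V := [set z | z = U (Cmap G z)].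

(* A solution on [0, +oo[ : continuous there and differentiable at all t > 0,
   with no restriction on the initial condition z 0. *)
Definition dmd_solution G (U : 'V -> 'V) (gamma : R) (z x u : R -> 'V) : Prop :=
  {within `[0, +oo[, continuous z} /\
  (forall (p : 'I_N) (t : R), 0 < t ->
     is_derive t (1 : R) (fun s => (z s) `^p p)
       (gamma *: (- (z t) `^p p + (u t) `^p p))) /\
  (forall (p : 'I_N) (t : R), 0 <= t ->
     (x t) `^p p = mirror_map (actions G p) (@psi p) ((z t) `^p p) /\
     (u t) `^p p = (U (x t)) `^p p).

Definition dmd_converges G (U : 'V -> 'V) (gamma : R) : Prop :=
  forall z x u : R -> 'V, dmd_solution G U gamma z x u ->
  exists zbar : 'V,
    [/\ rest_points G U zbar,
        z t @[t --> +oo] --> zbar,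
        x t @[t --> +oo] --> Cmap G zbar
      & perturbed_nash G (Cmap G zbar)].

End Regularized.
End Game.

Arguments game : clear implicits.
Arguments actions {R N n_} g p _.

(* Main.v *)
Require Import Defs.
From HB Require Import structures.
From mathcomp Require Import all_boot all_order all_algebra.
From mathcomp Require Import all_classical all_reals all_analysis.
From mathcomp Require Import ring lra.

(** The regularizers of all players add up to one lower semicontinuous function
psi on the convex set A of action profiles, strongly convex with modulus
sigma = eps * rho, and Cmap sends z to the point of A at which z is a
subgradient of psi.  With mu = 0 in the monotone cases, both parts say that the
dynamics converge when - U is mu-hypo-monotone on A and mu < sigma.

Existence of a rest point.  A rest point is zbar = U xbar where xbar solves the
variational inequality psi x + <U x, y - x> <= psi y for all y in A; this makes
U xbar a subgradient of psi at xbar, so that xbar = Cmap zbar.  Since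
mu < sigma, the gap function
  h y x = <U y, x - y> + psi y - psi x + mu / 2 * |x - y|^2
satisfies 0 <= h x y + h y x, is concave in x, and has closed and bounded sets
[h y x >= 0].  Minty's method then applies ([minty_point]): by compactness a
point x with h y x >= 0 for all y exists as soon as one exists for each finite
family of y's, and for a finite family it is given by an optimal strategy of a
matrix game of nonnegative value ([nonneg_game_strategy]).  Letting y tend to x
along segments gives the variational inequality
([subgradient_of_minty_gap]).  No fixed point theorem is involved.  The same
result with a constant operator shows that the maximum defining the mirror map
is attained ([Cmap_subgradient]).

Convergence.  Write C for Cmap, let conj z = max_y (<y, z> - psi y), whose
gradient is C, and let
  V z = conj z + psi xbar - <xbar, z>.
Strong convexity gives sigma / 2 * |C z - xbar|^2 <= V z, and convexity of conj
gives V z <= <C z - xbar, z - zbar>.  Along the dynamics, V has derivative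
gamma * <C z - xbar, - z + U (C z)>; hypo-monotonicity of - U and
cocoercivity of C bound it by - gamma * (1 - mu / sigma) * V.  Hence V decays
exponentially, C z tends to xbar, U (C z) tends to zbar, and z, being a
first-order linear filter of U (C z), tends to zbar as well
([mirror_descent_converges]).

Equilibrium.  At a rest point the p-th block of zbar is both the gradient of the
concave payoff of p and a subgradient of the regularizer of p; adding the two
first-order inequalities shows that no deviation of p improves the perturbed
payoff ([rest_point_perturbed_nash]). *)

Set Implicit Arguments.
Unset Strict Implicit.
Unset Printing Implicit Defensive.

Import Order.TTheory GRing.Theory Num.Theory.
Import numFieldNormedType.Exports.

Local Open Scope classical_set_scope.
Local Open Scope ring_scope.

(** * The Euclidean inner product *)

Section InnerProduct.
Context {R : realType} {m : nat}.
Implicit Types x y z : 'rV[R]_m.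

Lemma dotC x y : dot x y = dot y x.
Proof. by apply: eq_bigr => i _; rewrite mulrC. Qed.

Lemma dotDl x y z : dot (x + y) z = dot x z + dot y z.
Proof. by rewrite -big_split; apply: eq_bigr => i _; rewrite mxE mulrDl. Qed.

Lemma dotNl x y : dot (- x) y = - dot x y.
Proof. by rewrite -sumrN; apply: eq_bigr => i _; rewrite mxE mulNr. Qed.

Lemma dotZl a x y : dot (a *: x) y = a * dot x y.
Proof. by rewrite mulr_sumr; apply: eq_bigr => i _; rewrite mxE mulrA. Qed.

Lemma dotDr x y z : dot z (x + y) = dot z x + dot z y.
Proof. by rewrite dotC dotDl !(dotC z). Qed.

Lemma dotNr x y : dot y (- x) = - dot y x.
Proof. by rewrite dotC dotNl dotC. Qed.

Lemma dotZr a x y : dot y (a *: x) = a * dot y x.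
Proof. by rewrite dotC dotZl dotC. Qed.

Definition dotE := (dotDl, dotDr, dotNl, dotNr, dotZl, dotZr).

Lemma dot0l x : dot 0 x = 0.
Proof. by rewrite -(scale0r 0) dotZl mul0r. Qed.

Lemma dot0r x : dot x 0 = 0.
Proof. by rewrite dotC dot0l. Qed.

Lemma dotxx_ge0 x : 0 <= dot x x.
Proof. by apply: sumr_ge0 => i _; rewrite -expr2 sqr_ge0. Qed.

Lemma norm2_sq x : norm2 x ^+ 2 = dot x x.
Proof. by rewrite sqr_sqrtr// dotxx_ge0. Qed.

Lemma coord_sq_le_dot x i : x 0 i ^+ 2 <= dot x x.
Proof.
rewrite /dot (bigD1 i)//= -expr2 lerDl sumr_ge0// => j _.
by rewrite -expr2 sqr_ge0.
Qed.

Lemma dot_eq0 x : dot x x <= 0 -> x = 0.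
Proof.
move=> x0; apply/rowP => i; rewrite mxE; apply/eqP.
by rewrite -sqrf_eq0 eq_le sqr_ge0 (le_trans (coord_sq_le_dot x i)).
Qed.

Lemma young x y : 2 * dot x y <= dot x x + dot y y.
Proof. by have := dotxx_ge0 (x - y); rewrite !dotE (dotC y x); lra. Qed.

Lemma cvg_finite_sum (T I : Type) (F : set_system T) {FF : Filter F}
    (s : seq I) (f : I -> T -> R) (l : I -> R) :
  (forall i, f i t @[t --> F] --> l i) ->
  \sum_(i <- s) f i t @[t --> F] --> \sum_(i <- s) l i.
Proof. by move=> fl; apply: cvg_big => //; exact: add_continuous. Qed.

Lemma norm_le_coord x e : 0 <= e -> (forall i, `|x 0 i| <= e) -> `|x| <= e.
Proof.
move=> e0 xe; rewrite [leLHS]/Num.Def.normr/= mx_normrE.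
by apply: bigmax_le => // -[i j] _ /=; rewrite (ord1 i).
Qed.

(** The left-hand side is the sup norm.  The bound is crude but free of square
roots; boundedness arguments need no more. *)
Lemma norm_le_dot x : `|x| <= 1 + dot x x.
Proof.
have d0 := dotxx_ge0 x.
apply: norm_le_coord => [|i]; first lra.
have := coord_sq_le_dot x i; rewrite ler_norml; nra.
Qed.

Lemma cvg_coord (T : Type) (F : set_system T) {FF : Filter F}
    (f : T -> 'rV[R]_m) (l : 'rV[R]_m) i :
  f t @[t --> F] --> l -> f t 0 i @[t --> F] --> l 0 i.
Proof.
move=> fl.
have := cvg_comp f (fun M => M 0 i) fl (@coord_continuous R 1 m 0 i l).
by apply.
Qed.

Lemma cvg_dot (T : Type) (F : set_system T) {FF : Filter F}
    (f g : T -> 'rV[R]_m) (a b : 'rV[R]_m) :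
  f t @[t --> F] --> a -> g t @[t --> F] --> b ->
  dot (f t) (g t) @[t --> F] --> dot a b.
Proof.
by move=> fa gb; apply: cvg_finite_sum => i; apply: cvgM; exact: cvg_coord.
Qed.

Lemma cvg_row (T : Type) (F : set_system T) {FF : Filter F}
    (f : T -> 'rV[R]_m) (l : 'rV[R]_m) :
  (forall i, f t 0 i @[t --> F] --> l 0 i) -> f t @[t --> F] --> l.
Proof.
move=> fl; apply/cvgrPdist_le => e e0; near=> t.
apply: norm_le_coord (ltW e0) _ => i; rewrite !mxE; move: i.
near: t; apply: filter_forall => i.
by move/cvgrPdist_le : (fl i); exact.
Unshelve. all: by end_near. Qed.

End InnerProduct.

(** Stands for the limit t --> 0 in inequalities that are affine in t, such as
first-order conditions along a segment. *)
Lemma le0_small_multiples (R : realType) (a b : R) :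
  (forall t, 0 < t -> t <= 1 -> a <= t * b) -> a <= 0.
Proof.
move=> ab; rewrite leNgt; apply/negP => a0.
have b0 : 0 < b by have := ab 1 ltr01 (lexx _); lra.
have ab1 := ab 1 ltr01 (lexx _).
have t0 : 0 < a / (2 * b) by rewrite divr_gt0// mulr_gt0.
have t1 : a / (2 * b) <= 1 by rewrite ler_pdivrMr ?mulr_gt0//; lra.
have := ab _ t0 t1.
have -> : a / (2 * b) * b = a / 2 by field; rewrite gt_eqF.
lra.
Qed.

(** * Zero-sum matrix games *)

Section Simplex.
Context {R : realType} {n : nat}.

Definition simplex : set 'rV[R]_n :=
  [set w | (forall i, 0 <= w 0 i) /\ \sum_i w 0 i = 1].

Lemma simplex_compact : compact simplex.
Proof.
apply: bounded_closed_compact.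
  exists 1; split; first exact: num_real.
  move=> M M1 w [w0 ws].
  apply: norm_le_coord => [|i]; first lra.
  rewrite ger0_norm// (le_trans _ (ltW M1))//.
  by rewrite -ws (bigD1 i)//= lerDl sumr_ge0.
have -> : simplex =
    (\bigcap_i [set w | 0 <= w 0 i]) `&` [set w | \sum_i w 0 i = 1].
  by apply/seteqP; split=> w [w0 ws]; split=> // i; [move=> _|]; exact: w0.
apply: closedI.
  apply: closed_bigI => i _.
  have := @closed_comp _ _ (fun w : 'rV[R]_n => w 0 i) [set x : R | 0 <= x].
  apply; last exact: closed_ge.
  by move=> w _; exact: coord_continuous.
have := @closed_comp _ _ (fun w : 'rV[R]_n => \sum_i w 0 i) [set x : R | x = 1].
apply; last exact: closed_eq.
move=> w _; apply: (@cvg_finite_sum _ _ _ (nbhs w)) => i.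
exact: coord_continuous.
Qed.

End Simplex.

(** Because p^T M p >= 0 for every nonnegative vector p, the zero-sum game with
matrix M has nonnegative value.  A strategy w minimizing the total squared
shortfall of the payoffs is optimal: if the shortfall vector p did not vanish,
moving w towards the normalization of p would decrease this total to first
order. *)
Lemma nonneg_game_strategy (R : realType) (n : nat)
    (M : 'I_n.+1 -> 'I_n.+1 -> R) :
  (forall i j, 0 <= M i j + M j i) ->
  exists2 w : 'rV[R]_n.+1, simplex w & forall i, 0 <= \sum_j w 0 j * M i j.
Proof.
move=> M0.
pose pay (w : 'rV[R]_n.+1) i := \sum_j w 0 j * M i j.
pose short w i := Num.max 0 (- pay w i).
pose f w := \sum_i short w i ^+ 2.
have cpay i : continuous (pay^~ i).
  move=> w; apply: (@cvg_finite_sum _ _ _ (nbhs w)) => j.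
  by apply: cvgMr_tmp; exact: coord_continuous.
have cf : continuous f.
  move=> w; apply: (@cvg_finite_sum _ _ _ (nbhs w)) => i.
  have cs : {for w, continuous (short^~ i)}.
    apply: (@continuous_max R _ (cst 0)); first exact: cst_continuous.
    exact: (@continuousN R R _ (pay^~ i) w (cpay i w)).
  by rewrite expr2; under eq_fun do rewrite expr2; exact: cvgM.
have simplex0 : @simplex R n.+1 !=set0.
  exists (delta_mx 0 0); split=> [i|]; first by rewrite mxE; case: (_ && _).
  rewrite (bigD1 ord0)//= big1 ?addr0 ?mxE ?eqxx// => i /negPf i0.
  by rewrite mxE i0 andbF.
have [w] := compact_EVT_min simplex0 (@simplex_compact R n.+1)
  (continuous_subspaceT cf).
rewrite inE => sw fmin; exists w => // i0.
have [w0 ws] := sw.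
pose p i := short w i.
have p0 i : 0 <= p i by rewrite le_max lexx.
suff p_i0 : p i0 = 0.
  have : - pay w i0 <= p i0 by rewrite /p /short le_max lexx orbT.
  by rewrite p_i0 oppr_le0.
have ppay i : p i * pay w i = - p i ^+ 2.
  by rewrite /p /short; case: ltP => _; ring.
pose s := \sum_i p i.
have [s0|s_neq0] := eqVneq s 0.
  apply/eqP; move/eqP: s0; rewrite psumr_eq0// => /allP/(_ i0).
  by rewrite mem_index_enum => /(_ isT).
have sgt0 : 0 < s by rewrite lt_neqAle eq_sym s_neq0 sumr_ge0.
pose l : 'rV[R]_n.+1 := \row_i (p i / s).
have sl : simplex l.
  split=> [i|]; first by rewrite mxE divr_ge0// ltW.
  under eq_bigr do rewrite mxE.
  by rewrite -mulr_suml divff.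
pose d i := pay l i - pay w i.
have pay_path t i : pay (w + t *: (l - w)) i = pay w i + t * d i.
  rewrite /d /pay -sumrB mulr_sumr -big_split; apply: eq_bigr => j _ /=.
  by rewrite !mxE; ring.
have first_order : \sum_i p i * d i <= 0.
  suff : 2 * \sum_i p i * d i <= 0 by lra.
  apply: (@le0_small_multiples _ _ (\sum_i d i ^+ 2)) => t t0 t1.
  have spath : simplex (w + t *: (l - w)).
    have [l0 ls] := sl; split=> [i|].
      rewrite !mxE -/(l 0 i); have := l0 i; have := w0 i; rewrite mxE; nra.
    have -> : \sum_i (w + t *: (l - w)) 0 i
        = \sum_i w 0 i + t * (\sum_i l 0 i - \sum_i w 0 i).
      rewrite -sumrB mulr_sumr -big_split; apply: eq_bigr => i _ /=.
      by rewrite !mxE.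
    by rewrite ws ls subrr mulr0 addr0.
  have := fmin _ (mem_set spath) => fle.
  have fle2 : f (w + t *: (l - w)) <= \sum_i (p i - t * d i) ^+ 2.
    apply: ler_sum => i _; rewrite /p /short pay_path.
    by case: (leP 0 (- pay w i)) => h1;
      case: (leP 0 (- (pay w i + t * d i))) => h2; nra.
  have : t * (2 * \sum_i p i * d i) <= t * (t * \sum_i d i ^+ 2).
    have -> : t * (t * \sum_i d i ^+ 2) =
        t * (2 * \sum_i p i * d i) + (\sum_i (p i - t * d i) ^+ 2 - f w).
      rewrite /f -sumrB !mulr_sumr -big_split; apply: eq_bigr => i _ /=.
      by rewrite -/(p i); ring.
    rewrite lerDl; lra.
  by rewrite ler_pM2l.
have pMp : 0 <= \sum_i p i * pay l i.
  have E : \sum_i p i * pay l i = s^-1 * \sum_i \sum_j p i * p j * M i j.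
    rewrite mulr_sumr; apply: eq_bigr => i _; rewrite !mulr_sumr.
    by apply: eq_bigr => j _; rewrite mxE; ring.
  rewrite E mulr_ge0 ?invr_ge0 ?(ltW sgt0)//.
  rewrite -(pmulrn_lge0 _ (ltn0Sn 1)) mulr2n.
  rewrite [X in _ + X]exchange_big -big_split/= sumr_ge0// => i _.
  rewrite -big_split sumr_ge0// => j _ /=.
  by rewrite (mulrC (p j)) -mulrDr !mulr_ge0.
have pd : \sum_i p i * d i = \sum_i p i * pay l i + \sum_i p i ^+ 2.
  rewrite -big_split; apply: eq_bigr => i _ /=.
  by rewrite /d mulrBr ppay opprK.
have : p i0 ^+ 2 <= 0.
  have : p i0 ^+ 2 <= \sum_i p i ^+ 2.
    by rewrite (bigD1 i0)//= lerDl sumr_ge0// => i _; rewrite sqr_ge0.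
  lra.
by have := p0 i0; nra.
Qed.

(** * Minty's method *)

Section Jensen.
Context {R : realType} {E : lmodType R}.
Implicit Types (A : set E) (g : E -> R).

Definition convex_region A := forall x y t,
  A x -> A y -> 0 <= t <= 1 -> A (t *: x + (1 - t) *: y).

Definition concave_over A g := forall x y t,
  A x -> A y -> 0 <= t <= 1 ->
  t * g x + (1 - t) * g y <= g (t *: x + (1 - t) *: y).

Lemma convex_regionP A : convex_set A -> convex_region A.
Proof.
move=> cA x y t Ax Ay /andP[t0 t1]; have := cA x y (Itv01 t0 t1).
by move=> /(_ (mem_set Ax) (mem_set Ay)); rewrite inE.
Qed.

Lemma jensen A g n (w : 'I_n.+1 -> R) (x : 'I_n.+1 -> E) :
  convex_region A -> concave_over A g ->
  (forall i, 0 <= w i) -> \sum_i w i = 1 -> (forall i, A (x i)) ->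
  A (\sum_i w i *: x i) /\ \sum_i w i * g (x i) <= g (\sum_i w i *: x i).
Proof.
move=> cA cg; elim: n w x => [|n IHn] w x w0 w1 Ax.
  move: w1; rewrite !big_ord_recl !big_ord0 !addr0 => ->.
  by rewrite scale1r mul1r.
move: w1; rewrite !(big_ord_recl n.+1); set s := \sum_(i < _) w _ => w1.
have s0 : 0 <= s by exact: sumr_ge0.
have [s_eq0|s_neq0] := eqVneq s 0.
  have wi i : w (lift ord0 i) = 0.
    apply/eqP; move/eqP: s_eq0; rewrite psumr_eq0// => /allP/(_ i).
    by rewrite mem_index_enum => /(_ isT).
  have w01 : w ord0 = 1 by move: w1; rewrite s_eq0 addr0.
  rewrite w01 big1 => [|i _]; last by rewrite wi scale0r.
  rewrite big1 => [|i _]; last by rewrite wi mul0r.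
  by rewrite scale1r mul1r !addr0.
(* Past the first point, the remaining weights are renormalized by their sum. *)
have sgt0 : 0 < s by rewrite lt_neqAle eq_sym s_neq0.
pose v i := w (lift ord0 i) / s.
have [|||Av gv] := IHn v (fun i => x (lift ord0 i)).
- by move=> i; rewrite divr_ge0.
- by rewrite -mulr_suml divff.
- by move=> i; exact: Ax.
have -> : \sum_(i < n.+1) w (lift ord0 i) *: x (lift ord0 i) =
    (1 - w ord0) *: \sum_(i < n.+1) v i *: x (lift ord0 i).
  rewrite scaler_sumr; apply: eq_bigr => i _; rewrite scalerA; congr (_ *: _).
  by rewrite -w1 /v; field.
have -> : \sum_(i < n.+1) w (lift ord0 i) * g (x (lift ord0 i)) =
    (1 - w ord0) * \sum_(i < n.+1) v i * g (x (lift ord0 i)).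
  rewrite mulr_sumr; apply: eq_bigr => i _; rewrite mulrA; congr (_ * _).
  by rewrite -w1 /v; field.
have w01 : 0 <= w ord0 <= 1 by rewrite w0/= -w1 lerDl.
split; first exact: cA.
apply: le_trans (cg _ _ _ (Ax ord0) Av w01).
by rewrite lerD2l ler_wpM2l//; lra.
Qed.

End Jensen.

(** For a finite family of points y_i the optimal strategy w of
the game h y_i y_j yields, by concavity, the point \sum_j w_j y_j lying in
every superlevel set [set x | 0 <= h y_i x]; compactness of one of these sets
passes to the intersection of all of them. *)
Lemma minty_point (R : realType) (m : nat) (A : set 'rV[R]_m)
    (h : 'rV[R]_m -> 'rV[R]_m -> R) (y0 : 'rV[R]_m) :
  convex_region A -> A y0 ->
  (forall x y, A x -> A y -> 0 <= h x y + h y x) ->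
  (forall y, A y -> concave_over A (h y)) ->
  (forall y, A y -> closed [set x | A x /\ 0 <= h y x]) ->
  bounded_set [set x | A x /\ 0 <= h y0 x] ->
  exists2 x, A x & forall y, A y -> 0 <= h y x.
Proof.
move=> cA Ay0 hmon hconc hclosed hbnd.
pose K := [set x | A x /\ 0 <= h y0 x].
have cptK : compact K by apply: bounded_closed_compact => //; exact: hclosed.
have := cptK; rewrite compact_In0 /=.
move=> /(_ _ A (fun y => K `&` [set x | A x /\ 0 <= h y x])) [].
- by exists (fun y => [set x | A x /\ 0 <= h y x]).
- move=> D DA.
  (* y0 is added so that the family is nonempty and the point lies in K. *)
  pose s : seq 'rV[R]_m := y0 :: finmap.enum_fset D.
  have As (i : 'I_(size s)) : A (tnth (in_tuple s) i).
    have := mem_tnth i (in_tuple s); rewrite inE => /predU1P[->//|/DA].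
    by rewrite inE.
  have [i j|w [w0 w1] hw] := @nonneg_game_strategy R _
      (fun i j => h (tnth (in_tuple s) i) (tnth (in_tuple s) j)).
    exact: hmon.
  pose xbar := \sum_i w 0 i *: tnth (in_tuple s) i.
  have xbarP y : y \in s -> A xbar /\ 0 <= h y xbar.
    move=> ys; have Ay : A y.
      by move: ys; rewrite inE => /predU1P[->//|/DA]; rewrite inE.
    have [Ax hx] := jensen cA (hconc y Ay) w0 w1 As.
    split=> //; apply: le_trans hx.
    by have /tnthP[i ->] : y \in in_tuple s by []; exact: hw.
  exists xbar => y /= Dy; split; apply: xbarP; first exact: mem_head.
  by rewrite inE Dy orbT.
- move=> x Kx; exists x; first by have [[]] := Kx y0 Ay0.
  by move=> y Ay; have [_ []] := Kx y Ay.
Qed.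

(** * Variational inequalities with a strongly convex regularizer *)

Section Regularizer.
Context {R : realType} {m : nat}.
Implicit Types (A : set 'rV[R]_m) (psi : 'rV[R]_m -> R) (x y z : 'rV[R]_m).
Implicit Types (F : 'rV[R]_m -> 'rV[R]_m) (sigma mu : R).

Definition lsc_over A psi := forall x c, A x -> c < psi x ->
  \forall y \near x, A y -> c < psi y.

Definition strongly_convex_over A sigma psi := forall x y t,
  A x -> A y -> 0 <= t <= 1 ->
  psi (t *: x + (1 - t) *: y) <=
    t * psi x + (1 - t) * psi y - sigma / 2 * t * (1 - t) * dot (x - y) (x - y).

Definition regularizer A sigma psi :=
  [/\ convex_region A, closed A, lsc_over A psi
    & strongly_convex_over A sigma psi].

(** F is a gradient to be followed upwards: it is - F that is
mu-hypo-monotone. *)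
Definition hypomonotone_over A mu F := forall x y, A x -> A y ->
  dot (F x - F y) (x - y) <= mu * dot (x - y) (x - y).

Lemma sublevel_closed A psi (g : 'rV[R]_m -> R) :
  closed A -> lsc_over A psi -> continuous g ->
  closed [set x | A x /\ psi x <= g x].
Proof.
move=> clA lsc cg x clx.
have Ax : A x by apply: clA => B /clx [y [[Ay _] By]]; exists y.
split=> //; rewrite leNgt; apply/negP => gx.
pose c := (g x + psi x) / 2.
have gc : \forall y \near x, g y < c.
  by apply: (cvgr_lt (g x) (cg x)); rewrite /c; lra.
have cpsi : \forall y \near x, A y -> c < psi y.
  by apply: lsc => //; rewrite /c; lra.
have [y [[Ay gy] [gyc cy]]] := clx _ (filterI gc cpsi).
by have := cy Ay; lra.
Qed.

Lemma subr_continuous y : continuous (fun x : 'rV[R]_m => x - y).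
Proof.
move=> x; apply: (@cvgB _ _ _ (nbhs x) _ id (cst y)); first exact: cvg_id.
exact: (@cvg_cst).
Qed.

(** The Minty gap of the variational inequality for the operator mu * id - F and
the function psi - mu / 2 * |.|^2.  The shift by mu makes the operator monotone;
the function stays convex as long as mu does not exceed the modulus of psi. *)
Definition minty_gap psi mu F y x :=
  dot (F y) (x - y) + psi y - psi x + mu / 2 * dot (x - y) (x - y).

Lemma minty_gap_continuous mu F y :
  continuous (fun x => dot (F y) (x - y) + mu / 2 * dot (x - y) (x - y)).
Proof.
move=> x; have sub := @subr_continuous y x.
have cF := @cvg_cst 'rV[R]_m (F y) _ (nbhs x) (nbhs_filter x).
have cl := @cvg_dot _ _ _ (nbhs x) (nbhs_filter x) _ _ _ _ cF sub.
have cq := @cvg_dot _ _ _ (nbhs x) (nbhs_filter x) _ _ _ _ sub sub.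
exact: (cvgD cl (cvgMl_tmp cq)).
Qed.

Lemma minty_gap_point A sigma psi mu F y0 :
  regularizer A sigma psi -> mu <= sigma -> hypomonotone_over A mu F -> A y0 ->
  bounded_set [set x | A x /\ 0 <= minty_gap psi mu F y0 x] ->
  exists2 x, A x & forall y, A y -> 0 <= minty_gap psi mu F y x.
Proof.
move=> [cA clA lsc sc] mus hF Ay0 bnd.
apply: (minty_point cA Ay0) => //.
- move=> x y Ax Ay; have := hF x y Ax Ay.
  by rewrite /minty_gap !dotE (dotC y x); lra.
- move=> y Ay x x' t Ax Ax' t01; have := sc x x' t Ax Ax' t01.
  have d0 := dotxx_ge0 (x - x').
  have gap : 0 <= (sigma - mu) * (t * (1 - t) * dot (x - x') (x - x')).
    by have /andP[t0 t1] := t01; rewrite !mulr_ge0//; lra.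
  move: gap; rewrite /minty_gap !dotE (dotC x' x) (dotC y x) (dotC y x').
  by lra.
- move=> y Ay.
  have -> : [set x | A x /\ 0 <= minty_gap psi mu F y x] =
      [set x | A x /\ psi x <=
        psi y + (dot (F y) (x - y) + mu / 2 * dot (x - y) (x - y))].
    by apply/seteqP; split=> x [Ax]; rewrite /minty_gap => h; split=> //; lra.
  apply: sublevel_closed => // x.
  have cpsi := @cvg_cst R (psi y) _ (nbhs x) (nbhs_filter x).
  exact: (cvgD cpsi (@minty_gap_continuous mu F y x)).
Qed.

Lemma near_point_bounded A x0 (K : R) :
  (forall x, A x -> dot (x - x0) (x - x0) <= K) -> bounded_set A.
Proof.
move=> AK; exists (`|x0| + (1 + K)); split; first exact: num_real.
move=> M KM x Ax; apply: le_trans (ltW KM).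
rewrite -{1}(subrK x0 x) addrC (le_trans (ler_normD _ _))// lerD2l.
by rewrite (le_trans (norm_le_dot _))// lerD2l AK.
Qed.

(** A Minty point for F = 0 is a minimum of psi; on the part of A in the unit
ball around y0, which is compact, such a point exists. *)
Lemma bounded_below_near A sigma psi y0 :
  regularizer A sigma psi -> 0 <= sigma -> A y0 ->
  exists b, forall y, A y -> dot (y - y0) (y - y0) <= 1 -> b <= psi y.
Proof.
move=> [cA clA lsc sc] sigma0 Ay0.
pose B := [set y | A y /\ dot (y - y0) (y - y0) <= 1].
have [|||||x Bx xmin] := @minty_gap_point B sigma psi 0 (fun=> 0) y0.
- split.
  + move=> x y t [Ax Bx] [Ay By] t01; split; first exact: cA.
    have d0 := dotxx_ge0 (x - y).
    have gap : 0 <= t * (1 - t) * dot (x - y) (x - y).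
      by have /andP[t0 t1] := t01; rewrite !mulr_ge0//; lra.
    have /andP[t0 t1] := t01.
    have gx : t * dot (x - y0) (x - y0) <= t by rewrite ler_piMr.
    have gy : (1 - t) * dot (y - y0) (y - y0) <= 1 - t.
      by rewrite ler_piMr// subr_ge0.
    move: gap gx gy; rewrite !dotE (dotC y0 x) (dotC y0 y) (dotC y x); lra.
  + apply: (@sublevel_closed A (fun y => dot (y - y0) (y - y0))
      (fun=> 1)) => //.
      have cd : continuous (fun y => dot (y - y0) (y - y0)).
        move=> y; have sub := @subr_continuous y0 y.
        exact: (@cvg_dot _ _ _ (nbhs y) (nbhs_filter y) _ _ _ _ sub sub).
      move=> x c Ax cx.
      by apply: (@filterS _ (nbhs x) _ _ _ _ (cvgr_gt _ (cd x) _ cx)) => y.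
    by move=> x; exact: (@cvg_cst R 1 _ (nbhs x) (nbhs_filter x)).
  + move=> x c [Ax _] cx.
    apply: (@filterS _ (nbhs x) _ _ _ _ (lsc x c Ax cx)) => y h [Ay _].
    exact: h.
  + by move=> x y t [Ax _] [Ay _]; exact: sc.
- by [].
- by move=> x y _ _; rewrite subrr mul0r dot0l.
- by split=> //; rewrite subrr dot0l.
- by apply: (@near_point_bounded _ y0 1) => x [[_ ?] _].
exists (psi x) => y Ay y1; have := xmin y (conj Ay y1).
by rewrite /minty_gap mul0r mul0r addr0 dot0l; lra.
Qed.

(** Strong convexity with modulus larger than mu dominates the gap at infinity:
along the ray from y0 through x, comparison with the lower bound of psi at
distance 1 shows that psi x - psi y0 grows like sigma / 2 times the squared
distance. *)
Lemma minty_gap_bounded A sigma psi mu F y0 :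
  regularizer A sigma psi -> 0 <= mu -> mu < sigma -> A y0 ->
  bounded_set [set x | A x /\ 0 <= minty_gap psi mu F y0 x].
Proof.
move=> reg mu0 mus Ay0; have [cA clA lsc sc] := reg.
have sigma0 : 0 <= sigma by lra.
have [b bP] := bounded_below_near reg sigma0 Ay0.
(* Young's inequality with weight del bounds the linear term of the gap by K
   plus a quadratic term; psi x - psi y0 is then at most K plus
   (mu + del) / 2 times the squared distance, and (mu + del) / 2 < sigma / 2. *)
pose del := (sigma - mu) / 2.
have del0 : 0 < del by rewrite /del; lra.
pose K := dot (F y0) (F y0) / (2 * del).
have K0 : 0 <= K by rewrite divr_ge0 ?dotxx_ge0// mulr_ge0// ltW.
pose r0 := (K + sigma / 2 + psi y0 - b) / (del / 2).
apply: (@near_point_bounded _ y0 (1 + r0 ^+ 2)) => x [Ax gapx].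
set d := dot (x - y0) (x - y0).
have d_ge0 : 0 <= d by exact: dotxx_ge0.
have [d1|d1] := leP d 1; first by rewrite (le_trans d1)// lerDl sqr_ge0.
pose r := Num.sqrt d.
have r2 : r ^+ 2 = d by rewrite sqr_sqrtr.
have r1 : 1 < r by rewrite -sqrtr1 ltr_sqrt// (lt_trans ltr01).
have r0' : 0 < r by lra.
(* The point at parameter t is at distance 1 from y0. *)
pose t := r^-1.
have tr : t * r = 1 by rewrite mulVf// gt_eqF.
have t01 : 0 <= t <= 1 by rewrite invr_ge0 ltW//= invf_le1// ltW.
have Ay := cA x y0 t Ax Ay0 t01.
have E : t *: x + (1 - t) *: y0 - y0 = t *: (x - y0).
  by rewrite scalerBl scale1r scalerBr (addrC y0) addrA addrK.
have := bP _ Ay; rewrite E !dotZl dotZr -/d.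
have td : t * d = r by rewrite -r2 expr2 mulrA tr mul1r.
rewrite td tr => /(_ (lexx _)) blow.
have up := sc x y0 t Ax Ay0 t01; rewrite -/d in up.
have youngF : dot (F y0) (x - y0) <= K + del / 2 * d.
  have := young (F y0) (del *: (x - y0)); rewrite !dotZl !dotZr -/d => yg.
  rewrite -(ler_pM2l (_ : 0 < 2 * del)); last by rewrite mulr_gt0.
  have -> : 2 * del * (K + del / 2 * d) = dot (F y0) (F y0) + del * (del * d).
    by rewrite /K; field; rewrite gt_eqF.
  lra.
have psix : psi x - psi y0 <= K + (mu + del) / 2 * d.
  by move: gapx; rewrite /minty_gap -/d; lra.
have tpsi : t * (psi x - psi y0) <= t * (K + (mu + del) / 2 * d).
  by rewrite ler_wpM2l//; case/andP: t01.
have tK : t * K <= K by rewrite ler_piMl//; case/andP: t01.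
have E1 : t * (K + (mu + del) / 2 * d) = t * K + (mu + del) / 2 * r.
  by rewrite -td; ring.
have E2 : sigma / 2 * t * (1 - t) * d = sigma / 2 * (r - 1).
  have -> : sigma / 2 * t * (1 - t) * d = sigma / 2 * ((t * d) - t * (t * d)).
    by ring.
  by rewrite td tr.
have rle : r <= r0.
  rewrite /r0 ler_pdivlMr; last by rewrite divr_gt0.
  have h : (mu + del) / 2 * r - sigma / 2 * r = - (r * (del / 2)).
    by rewrite /del; field.
  lra.
rewrite -r2 (@le_trans _ _ (r0 ^+ 2))//; last by rewrite lerDr.
by rewrite ler_sqr ?nnegrE; lra.
Qed.

End Regularizer.

(** * Mirror maps *)

Lemma cvg_to_within (T U : Type) (F : set_system T) {FF : Filter F}
    (G : set_system U) (D : set U) (f : T -> U) :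
  f t @[t --> F] --> G -> (\forall t \near F, D (f t)) ->
  f t @[t --> F] --> within D G.
Proof.
move=> fG fD B GB; have FB : F (fun t => D (f t) -> B (f t)) by exact: fG GB.
by apply: filterS2 FB fD => t; exact.
Qed.

Section Mirror.
Context {R : realType} {m : nat}.
Implicit Types (A : set 'rV[R]_m) (psi : 'rV[R]_m -> R) (x y z : 'rV[R]_m).
Implicit Types (F : 'rV[R]_m -> 'rV[R]_m) (sigma mu : R).

(** Equivalently, x maximizes dot y z - psi y over y in A, so that x is the
image of z under the mirror map. *)
Definition subgradient_over A psi z x :=
  A x /\ forall y, A y -> psi x + dot z (y - x) <= psi y.

Lemma segment_point x y t : x + t *: (y - x) = t *: y + (1 - t) *: x.
Proof. by rewrite scalerBr scalerBl scale1r addrCA addrA. Qed.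

(** Minty's trick: testing the gap inequality at points tending to x along a
segment turns it into a variational inequality at x itself. *)
Lemma subgradient_of_minty_gap A sigma psi mu F x :
  regularizer A sigma psi -> 0 <= sigma -> {within A, continuous F} -> A x ->
  (forall y, A y -> 0 <= minty_gap psi mu F y x) ->
  subgradient_over A psi (F x) x.
Proof.
move=> [cA clA lsc sc] sigma0 /subspace_continuousP cF Ax gap; split=> // y Ay.
pose p t := x + t *: (y - x).
have Ap t : 0 <= t <= 1 -> A (p t) by rewrite /p segment_point; exact: cA.
pose d := dot (y - x) (y - x).
have d0 : 0 <= d by exact: dotxx_ge0.
have step t : 0 < t -> t <= 1 ->
    dot (F (p t)) (y - x) <= psi y - psi x + t * (mu / 2 * d).
  move=> t0 t1; have t01 : 0 <= t <= 1 by rewrite ltW.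
  have := gap _ (Ap t t01); have := sc y x t Ay Ax t01.
  rewrite -segment_point -/(p t) /minty_gap -/d.
  have -> : x - p t = - (t *: (y - x)) by rewrite /p opprD addNKr.
  rewrite !(dotNl (t *: _)) !dotNr !(dotZr t) (dotZl t) -/d => scp gapp.
  have loss : 0 <= sigma / 2 * t * (1 - t) * d.
    by rewrite !mulr_ge0//; lra.
  by rewrite -(ler_pM2l t0); lra.
have cp : p t @[t --> 0^'+] --> within A (nbhs x).
  apply: cvg_to_within; last first.
    near=> t; apply: Ap; apply/andP; split; near: t; first exact: nbhs_right_ge.
    exact: nbhs_right_le.
  have p0 : p 0 = x by rewrite /p scale0r addr0.
  suff : p t @[t --> 0^'+] --> p 0 by rewrite p0.
  apply: cvg_at_right_filter; apply: cvg_row => i.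
  rewrite /p; under eq_fun do rewrite !mxE; rewrite !mxE.
  apply: cvgD; first exact: cvg_cst.
  by apply: cvgMr_tmp; exact: cvg_id.
have lim1 : dot (F (p t)) (y - x) @[t --> 0^'+] --> dot (F x) (y - x).
  apply: cvg_dot; last exact: cvg_cst.
  exact: (cvg_comp _ _ cp (cF x Ax)).
have lim2 : psi y - psi x + t * (mu / 2 * d) @[t --> 0^'+] --> psi y - psi x.
  rewrite -[X in _ --> X]addr0 -[X in _ --> _ + X](mul0r (mu / 2 * d)).
  apply: cvgD; first exact: cvg_cst.
  by apply: cvgMr_tmp; apply: cvg_at_right_filter; exact: cvg_id.
have : dot (F x) (y - x) <= psi y - psi x.
  apply: (ler_cvg_to lim1 lim2).
  near=> t; apply: step; near: t; first exact: nbhs_right_gt.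
  exact: nbhs_right_le.
lra.
Unshelve. all: by end_near. Qed.

Lemma variational_inequality_solvable A sigma psi mu F :
  regularizer A sigma psi -> A !=set0 -> 0 <= mu -> mu < sigma ->
  hypomonotone_over A mu F -> {within A, continuous F} ->
  exists x, subgradient_over A psi (F x) x.
Proof.
move=> reg [y0 Ay0] mu0 mus hF cF.
have [x Ax gap] := minty_gap_point reg (ltW mus) hF Ay0
  (minty_gap_bounded F reg mu0 mus Ay0).
exists x; apply: subgradient_of_minty_gap reg _ cF Ax gap.
by rewrite (le_trans mu0)// ltW.
Qed.

Section StrongConvexity.
Variables (A : set 'rV[R]_m) (sigma : R) (psi : 'rV[R]_m -> R).
Hypotheses (reg : regularizer A sigma psi) (sigma0 : 0 < sigma).

Lemma subgradient_quadratic z x y : subgradient_over A psi z x -> A y ->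
  psi x + dot z (y - x) + sigma / 2 * dot (y - x) (y - x) <= psi y.
Proof.
move=> [Ax zx] Ay; have [cA _ _ sc] := reg; set d := dot (y - x) (y - x).
rewrite -subr_le0; apply: (@le0_small_multiples _ _ (sigma / 2 * d)) => t t0 t1.
have t01 : 0 <= t <= 1 by rewrite ltW.
have := zx _ (cA y x t Ay Ax t01); have := sc y x t Ay Ax t01.
rewrite -segment_point (addrC x) addrK dotZr -/d => scp zp.
by rewrite -(ler_pM2l t0); lra.
Qed.

Lemma subgradient_cocoercive z z' x x' :
  subgradient_over A psi z x -> subgradient_over A psi z' x' ->
  sigma * dot (x - x') (x - x') <= dot (x - x') (z - z').
Proof.
move=> zx zx'.
have := subgradient_quadratic zx zx'.1; have := subgradient_quadratic zx' zx.1.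
rewrite !dotE (dotC x' x) (dotC x z) (dotC x' z) (dotC x z') (dotC x' z'); lra.
Qed.

Lemma subgradient_unique z x x' :
  subgradient_over A psi z x -> subgradient_over A psi z x' -> x = x'.
Proof.
move=> zx zx'; have := subgradient_cocoercive zx zx'.
rewrite subrr dot0r pmulr_rle0// => /dot_eq0 /eqP; rewrite subr_eq0 => /eqP//.
Qed.

Variable C : 'rV[R]_m -> 'rV[R]_m.
Hypothesis CP : forall z, subgradient_over A psi z (C z).

Definition conjugate z := dot (C z) z - psi (C z).

(** The gradient of the conjugate is C, with a quadratic error bound: the lower
bound is convexity, and the upper bound comes from C being cocoercive, hence
Lipschitz. *)
Lemma conjugate_expansion z z' :
  0 <= conjugate z' - conjugate z - dot (C z) (z' - z)
    <= sigma^-1 * dot (z' - z) (z' - z).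
Proof.
have := subgradient_quadratic (CP z) (CP z').1.
have := subgradient_quadratic (CP z') (CP z).1.
have := subgradient_cocoercive (CP z') (CP z).
rewrite /conjugate; set x := C z; set x' := C z'.
have dE : dot (x - x') (x - x') = dot (x' - x) (x' - x).
  by rewrite -opprB dotNl dotNr opprK.
have := young (sigma *: (x' - x)) (z' - z).
have := dotxx_ge0 (x' - x); rewrite dE !(dotZl sigma) !(dotZr sigma).
set d := dot (x' - x) _ => d0 yg co h1 h2.
have sd0 : 0 <= sigma / 2 * d by rewrite mulr_ge0// divr_ge0// ltW.
apply/andP; split.
  by move: h1; rewrite !dotE (dotC z' x) (dotC z' x'); lra.
have le1 : dot x' z' - psi x' - (dot x z - psi x) - dot x (z' - z)
    <= dot (x' - x) (z' - z).
  by move: h2; rewrite !dotE (dotC z x) (dotC z x'); lra.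
rewrite ler_pdivlMl//.
have : sigma * (sigma * d) <= sigma * dot (x' - x) (z' - z) by rewrite ler_pM2l.
by move: le1; rewrite -(ler_pM2l sigma0); lra.
Qed.

End StrongConvexity.
End Mirror.

(** * Scalar differential inequalities *)

Section ScalarODE.
Context {R : realType}.
Implicit Types (f r q : R -> R).

(** (f t - b) * expR (c * (t - T)) is nonincreasing, and the exponential is at
least 1 + c * (t - T), which is unbounded. *)
Lemma eventually_below f (f' : R -> R) (c b T e : R) : 0 < c -> 0 < e ->
  (forall t : R, T <= t -> is_derive t (1 : R) f (f' t)) ->
  (forall t : R, T <= t -> f' t <= - c * (f t - b)) ->
  \forall t \near +oo, f t < b + e.
Proof.
move=> c0 e0 df f'b.
pose E t := expR (c * (t - T)).
pose g t := (f t - b) * E t.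
have dE t : is_derive t (1 : R) E (c * E t).
  have dl : is_derive t (1 : R) (fun s : R => c * (s - T)) c.
    by apply: is_derive_eq; rewrite /GRing.scale/=; ring.
  by apply: is_derive_eq; rewrite /E /GRing.scale/=; ring.
have dg t : T <= t -> is_derive t (1 : R) g ((f' t + c * (f t - b)) * E t).
  move=> Tt; have dft := df t Tt.
  have := dE t => dEt.
  by apply: is_derive_eq; rewrite /GRing.scale/=; ring.
have gdec t : T <= t -> g t <= g T.
  move=> Tt; apply: (@ler0_derive1_nincry R g T) => //.
  - move=> s; rewrite in_itv/= andbT => /ltW Ts.
    by apply: ex_derive; exact: dg.
  - move=> s; rewrite in_itv/= andbT => /ltW Ts.
    rewrite derive1E (derive_val (is_derive := dg s Ts)).
    by rewrite mulr_le0_ge0 ?expR_ge0//; have := f'b s Ts; lra.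
  - apply: derivable_within_continuous => s; rewrite in_itv/= andbT => Ts.
    by apply: ex_derive; exact: dg.
near=> t.
have Tt : T <= t by near: t; apply: nbhs_pinfty_ge; exact: num_real.
rewrite ltNge; apply/negP => ft.
have := gdec t Tt; rewrite /g {2}/E subrr mulr0 expR0 mulr1.
have tbig : T + `|f T - b| / (e * c) <= t.
  by near: t; apply: nbhs_pinfty_ge; exact: num_real.
have E1 : 1 + c * (t - T) <= E t by exact: expR_ge1Dx.
have D1 : `|f T - b| <= e * (c * (t - T)).
  rewrite mulrA -ler_pdivrMl ?mulr_gt0// mulrC; lra.
have absD : f T - b <= `|f T - b| by exact: ler_norm.
have : e * (1 + c * (t - T)) <= (f t - b) * E t.
  apply: ler_pM => //; [exact: ltW| |lra].
  by rewrite addr_ge0// mulr_ge0 ?subr_ge0// ltW.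
lra.
Unshelve. all: by end_near. Qed.

(** Once u is within e / 2 of l, the comparison lemma applies to f with bound
l + e / 2 and to - f with bound - l + e / 2. *)
Lemma linear_filter_cvg f (u : R -> R) (c l : R) : 0 < c ->
  (forall t : R, 0 < t -> is_derive t (1 : R) f (c * (- f t + u t))) ->
  u t @[t --> +oo] --> l -> f t @[t --> +oo] --> l.
Proof.
move=> c0 df ul; apply/cvgrPdist_lt => e e0.
have e20 : 0 < e / 2 by rewrite divr_gt0.
have /cvgrPdist_lt/(_ _ e20) [T [_ uT]] := ul.
pose T' := Num.max 1 (T + 1).
have T'0 t : T' <= t -> 0 < t by rewrite ge_max => /andP[? _]; lra.
have T'T t : T' <= t -> `|l - u t| < e / 2.
  by rewrite ge_max => /andP[_ ?]; apply: uT; lra.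
have up : \forall t \near +oo, f t < l + e / 2 + e / 2.
  apply: (@eventually_below f _ c _ T') => // [t T't|t T't].
    by apply: df; exact: T'0.
  have := T'T t T't; rewrite ltr_norml => /andP[h _].
  by rewrite mulNr -mulrN ler_pM2l//; lra.
have down : \forall t \near +oo, - f t < - l + e / 2 + e / 2.
  apply: (@eventually_below (fun t => - f t)
    (fun t => - (c * (- f t + u t))) c _ T') => // [t T't|t T't].
    by have dft := df t (T'0 t T't); apply: is_derive_eq.
  have := T'T t T't; rewrite ltr_norml => /andP[_ h].
  by rewrite mulNr lerN2 ler_pM2l//; lra.
near=> t; rewrite ltr_norml; apply/andP; split.
  suff : f t < l + e / 2 + e / 2 by lra.
  by near: t.
suff : - f t < - l + e / 2 + e / 2 by lra.
by near: t.
Unshelve. all: by end_near. Qed.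

Lemma is_derive0_squeeze r q (t : R) :
  (forall s : R, 0 <= r s <= q s) -> q t = 0 -> is_derive t (1 : R) q 0 ->
  is_derive t (1 : R) r 0.
Proof.
move=> rq qt dq.
have rt : r t = 0.
  by apply/eqP; rewrite eq_le; have := rq t; rewrite qt andbC.
have cr : (fun h => h^-1 *: ((r \o shift t) (h *: (1 : R)) - r t)) @ 0^' --> (0 : R).
  have : (fun h => h^-1 *: ((q \o shift t) (h *: (1 : R)) - q t)) @ 0^' --> (0 : R).
    have [/cvg_ex[l ql] dq0] := dq.
    suff l0 : l = 0 by rewrite l0 in ql.
    by rewrite -dq0; apply/esym; exact: (cvg_lim _ ql).
  move=> /cvgrPdist_le cq; apply/cvgrPdist_le => e e0.
  apply: filterS (cq e e0) => h /=.
  rewrite !sub0r !normrN rt qt !subr0 !normrZ; apply: le_trans.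
  rewrite ler_wpM2l//.
  have /andP[r0 rq'] := rq (h *: (1 : R) + t).
  by rewrite !ger0_norm// (le_trans r0).
apply: DeriveDef; first by apply/cvg_ex; exists 0.
by apply/cvg_lim.
Qed.

Lemma is_derive_dot m (z : R -> 'rV[R]_m) (y dz : 'rV[R]_m) t :
  (forall i, is_derive t (1 : R) (fun s => z s 0 i) (dz 0 i)) ->
  is_derive t (1 : R) (fun s => dot y (z s)) (dot y dz).
Proof.
move=> dzi.
have -> : (fun s => dot y (z s)) = \sum_i (fun s => y 0 i * z s 0 i).
  by apply/funext => s; rewrite fct_sumE.
exact: is_derive_sum.
Qed.

Lemma is_derive_dist2 m (z : R -> 'rV[R]_m) (dz : 'rV[R]_m) t :
  (forall i, is_derive t (1 : R) (fun s => z s 0 i) (dz 0 i)) ->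
  is_derive t (1 : R) (fun s => dot (z s - z t) (z s - z t)) 0.
Proof.
move=> dzi.
have -> : (fun s => dot (z s - z t) (z s - z t)) =
    \sum_i (fun s => (z s 0 i - z t 0 i) * (z s 0 i - z t 0 i)).
  by apply/funext => s; rewrite fct_sumE; apply: eq_bigr => i _; rewrite !mxE.
rewrite -[X in is_derive _ _ _ X](_ : \sum_(i < m) 0 = 0); last by rewrite big1.
apply: is_derive_sum => i; have := dzi i => dzii.
by apply: is_derive_eq; rewrite /GRing.scale/=; ring.
Qed.

End ScalarODE.

(** * Convergence of discounted mirror descent *)

Section Convergence.
Context {R : realType} {m : nat}.
Variables (A : set 'rV[R]_m) (sigma mu gamma : R) (psi : 'rV[R]_m -> R).
Variables (C F : 'rV[R]_m -> 'rV[R]_m) (z : R -> 'rV[R]_m).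
Hypotheses (reg : regularizer A sigma psi) (A_neq0 : A !=set0).
Hypotheses (mu_ge0 : 0 <= mu) (mu_lt : mu < sigma) (gamma_gt0 : 0 < gamma).
Hypothesis F_hypo : hypomonotone_over A mu F.
Hypothesis F_cont : {within A, continuous F}.
Hypothesis CP : forall z, subgradient_over A psi z (C z).
Hypothesis z_ode : forall (t : R) i, 0 < t ->
  is_derive t (1 : R) (fun s => z s 0 i) (gamma * (- z t 0 i + F (C (z t)) 0 i)).

Let sigma_gt0 : 0 < sigma. Proof. exact: le_lt_trans mu_lt. Qed.

(** C need not be differentiable, so the quadratic remainder of
[conjugate_expansion] takes the place of a chain rule. *)
Lemma conjugate_derivative (t : R) : 0 < t ->
  is_derive t (1 : R) (fun s => conjugate psi C (z s))
    (dot (C (z t)) (gamma *: (- z t + F (C (z t))))).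
Proof.
move=> t0; set dz := gamma *: _.
have dzi i : is_derive t (1 : R) (fun s => z s 0 i) (dz 0 i).
  by rewrite !mxE; exact: z_ode.
pose r s := conjugate psi C (z s) - conjugate psi C (z t)
  - dot (C (z t)) (z s - z t).
pose q s := sigma^-1 * dot (z s - z t) (z s - z t).
have dr : is_derive t (1 : R) r 0.
  apply: (@is_derive0_squeeze _ _ q).
  - by move=> s; exact: (conjugate_expansion reg sigma_gt0).
  - by rewrite /q subrr dot0l mulr0.
  - have d2 := is_derive_dist2 dzi.
    by apply: is_derive_eq; rewrite /GRing.scale/=; ring.
have -> : (fun s => conjugate psi C (z s)) = (fun s => r s +
    (dot (C (z t)) (z s) + (conjugate psi C (z t) - dot (C (z t)) (z t)))).
  by apply/funext => s; rewrite /r dotDr dotNr; ring.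
have dd := @is_derive_dot _ _ z (C (z t)) dz t dzi.
by apply: is_derive_eq; rewrite add0r addr0.
Qed.

(** The Lyapunov function V is the Fenchel coupling of the equilibrium xb and
z t: it dominates the squared distance from C (z t) to xb and decays
exponentially along the trajectory. *)
Lemma mirror_descent_converges : exists zbar,
  [/\ zbar = F (C zbar), z t @[t --> +oo] --> zbar
    & C (z t) @[t --> +oo] --> C zbar].
Proof.
have [xb xbP] :=
  variational_inequality_solvable reg A_neq0 mu_ge0 mu_lt F_hypo F_cont.
have Axb := xbP.1.
pose zb := F xb.
have CzbE : C zb = xb := subgradient_unique reg sigma_gt0 (CP zb) xbP.
pose V t := conjugate psi C (z t) - dot xb (z t) + psi xb.
pose d t := dot (C (z t) - xb) (C (z t) - xb).
have V_ge t : sigma / 2 * d t <= V t.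
  have := subgradient_quadratic reg (CP (z t)) Axb.
  have -> : dot (xb - C (z t)) (xb - C (z t)) = d t.
    by rewrite /d -opprB dotNl dotNr opprK.
  by rewrite /V /conjugate !dotE (dotC (z t) xb) (dotC (z t)); lra.
have V_le t : V t <= dot (C (z t) - xb) (z t - zb).
  have := xbP.2 _ (CP (z t)).1.
  by rewrite /V /conjugate -/zb !dotE (dotC zb) (dotC zb xb); lra.
pose V' t := dot (C (z t) - xb) (gamma *: (- z t + F (C (z t)))).
have dV (t : R) : 0 < t -> is_derive t (1 : R) V (V' t).
  move=> t0; have dc := conjugate_derivative t0.
  have dzi i : is_derive t (1 : R) (fun s => z s 0 i)
      ((gamma *: (- z t + F (C (z t)))) 0 i).
    by rewrite !mxE; exact: z_ode.
  have dd := @is_derive_dot _ _ z xb _ t dzi.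
  by apply: is_derive_eq; rewrite addr0 /V' dotDl dotNl.
(* Cocoercivity turns the hypo-monotonicity defect mu * d t into the fraction
   mu / sigma of the dissipation dot (C z - xb) (z - zb). *)
pose c := gamma * (1 - mu / sigma).
have c_gt0 : 0 < c.
  by rewrite mulr_gt0// subr_gt0 ltr_pdivrMr// mul1r.
have V'_le t : V' t <= - c * (V t - 0).
  have hyp := F_hypo (CP (z t)).1 Axb.
  have coc := subgradient_cocoercive reg (CP (z t)) xbP.
  rewrite -/zb in coc; rewrite -/zb in hyp.
  have musig : mu * d t <= mu / sigma * dot (C (z t) - xb) (z t - zb).
    have -> : mu * d t = mu / sigma * (sigma * d t) by field; rewrite gt_eqF.
    by rewrite ler_wpM2l// divr_ge0// ltW.
  have V'E : V' t = gamma * (dot (F (C (z t)) - zb) (C (z t) - xb)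
      - dot (C (z t) - xb) (z t - zb)).
    rewrite /V' dotZr; congr (_ * _).
    by rewrite (dotC (_ - zb)) !dotE; ring.
  rewrite V'E subr0 /c mulNr -mulrA -mulrN ler_pM2l//.
  have k_ge0 : 0 <= 1 - mu / sigma by rewrite subr_ge0 ler_pdivrMr// mul1r ltW.
  have := ler_wpM2l k_ge0 (V_le t); rewrite /d in musig *; lra.
have d_cvg e : 0 < e -> \forall t \near +oo, d t < e.
  move=> e0; have e'0 : 0 < sigma / 2 * e by rewrite mulr_gt0// divr_gt0.
  have := @eventually_below _ V V' c 0 1 _ c_gt0 e'0
    (fun t t1 => dV t (lt_le_trans ltr01 t1)) (fun t _ => V'_le t).
  apply: filterS => t; rewrite add0r => Vt.
  by rewrite -(ltr_pM2l (_ : 0 < sigma / 2)) ?(le_lt_trans (V_ge t))// divr_gt0.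
have x_cvg : C (z t) @[t --> +oo] --> xb.
  apply: cvg_row => i; apply/cvgrPdist_lt => e e0.
  have e20 : 0 < e ^+ 2 by rewrite exprn_gt0.
  apply: filterS (d_cvg _ e20) => t dt.
  rewrite distrC -ltr_sqr ?nnegrE ?(ltW e0)//.
  rewrite real_normK ?num_real//.
  have := coord_sq_le_dot (C (z t) - xb) i.
  by rewrite !mxE => /le_lt_trans; apply.
have u_cvg : F (C (z t)) @[t --> +oo] --> zb.
  have xA : C (z t) @[t --> +oo] --> within A (nbhs xb).
    apply: cvg_to_within => //.
    by near=> t; have [] := CP (z t).
  move/subspace_continuousP : F_cont => /(_ xb Axb) cF.
  exact: (cvg_comp _ _ xA cF).
exists zb; split; first by rewrite CzbE.
  apply: cvg_row => i; apply: (@linear_filter_cvg _ (fun t => z t 0 i)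
    (fun t => F (C (z t)) 0 i) gamma) => //.
  exact: cvg_coord.
by rewrite CzbE.
Unshelve. all: by end_near. Qed.

End Convergence.

(** * First-order condition for concave payoffs *)

Section ConcaveGradient.
Context {R : realType} {m : nat}.
Implicit Types (A : set 'rV[R]_m) (f : 'rV[R]_m -> R) (x y g : 'rV[R]_m).

Lemma concave_functionP A f : concave_function A f -> concave_over A f.
Proof.
move=> cf x y t Ax Ay /andP[t0 t1].
have := cf (Itv01 t0 t1) x y (mem_set Ax) (mem_set Ay).
rewrite !convRE/= /unstable.onem.
lra.
Qed.

(** The expansion of f holds only along A, but the segment from x to y stays in
A by convexity, and there the error quotient is bounded below by the one at
y. *)
Lemma concave_gradient_le A f x g y :
  convex_region A -> concave_over A f -> has_gradient_within A f x g ->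
  A x -> A y -> f y - f x <= dot g (y - x).
Proof.
move=> cA cf fg Ax Ay.
have [->|yx] := eqVneq y x; first by rewrite !subrr dot0r.
have d_gt0 : 0 < dot (y - x) (y - x).
  rewrite ltNge; apply/negP => /dot_eq0/eqP; rewrite subr_eq0.
  by rewrite (negPf yx).
pose n := norm2 (y - x).
have n_gt0 : 0 < n by rewrite sqrtr_gt0.
pose p t := x + t *: (y - x).
have Ap t : 0 <= t <= 1 -> A (p t) by rewrite /p segment_point; exact: cA.
pose quot z := (f z - f x - dot g (z - x)) / norm2 (z - x).
have cp : p t @[t --> 0^'+] --> within A x^'.
  apply: cvg_to_within; last first.
    near=> t; apply: Ap; apply/andP; split; near: t; first exact: nbhs_right_ge.
    exact: nbhs_right_le.
  apply: cvg_to_within; last first.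
    near=> t; apply/eqP => /eqP; rewrite -subr_eq0 /p (addrC x) addrK.
    rewrite scaler_eq0 subr_eq0 (negPf yx) orbF; apply/negP.
    by rewrite gt_eqF//; near: t; exact: nbhs_right_gt.
  have p0 : p 0 = x by rewrite /p scale0r addr0.
  suff : p t @[t --> 0^'+] --> p 0 by rewrite p0.
  apply: cvg_at_right_filter; apply: cvg_row => i.
  rewrite /p; under eq_fun do rewrite !mxE; rewrite !mxE.
  apply: cvgD; first exact: cvg_cst.
  by apply: cvgMr_tmp; exact: cvg_id.
have qlim : quot (p t) @[t --> 0^'+] --> (0 : R) by exact: (cvg_comp _ _ cp fg).
suff : (f y - f x - dot g (y - x)) / n <= 0.
  by rewrite pmulr_lle0 ?invr_gt0// subr_le0.
apply: (ler_cvg_to (cvg_cst _) qlim); near=> t.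
have t0 : 0 < t by near: t; exact: nbhs_right_gt.
have t1 : t <= 1 by near: t; exact: nbhs_right_le.
have t01 : 0 <= t <= 1 by rewrite ltW.
have px : p t - x = t *: (y - x) by rewrite /p (addrC x) addrK.
have npx : norm2 (p t - x) = t * n.
  rewrite /norm2 px dotZl dotZr mulrA sqrtrM ?mulr_ge0 ?ltW//.
  by rewrite -expr2 sqrtr_sqr gtr0_norm.
rewrite /quot npx px dotZr ler_pdivlMr ?mulr_gt0//.
have -> : (f y - f x - dot g (y - x)) / n * (t * n) =
    t * (f y - f x - dot g (y - x)).
  by field; rewrite gt_eqF.
have := cf y x t Ay Ax t01; rewrite -segment_point -/(p t); lra.
Unshelve. all: by end_near. Qed.

End ConcaveGradient.

(** * Block decomposition of profiles *)

Section Blocks.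
Context {R : realType} {N : nat} {n_ : 'I_N -> nat}.
Local Notation "''V'" := 'rV[R]_(\sum_p n_ p) (at level 0).
Implicit Types x y z : 'V.

Lemma dot_blocks x y : dot x y = \sum_p dot (submxrow x p) (submxrow y p).
Proof.
have dotM k (a b : 'rV[R]_k) : dot a b = (a *m b^T) 0 0.
  by rewrite mxE; apply: eq_bigr => i _; rewrite mxE.
rewrite dotM -{1}(submxrowK x) -{1}(submxrowK y) tr_mxrow mul_mxrow_mxcol.
by rewrite summxE; apply: eq_bigr => p _; rewrite dotM.
Qed.

Lemma submxrow_continuous p : continuous (fun x : 'V => submxrow x p).
Proof.
move=> x; apply: (@cvg_row _ _ _ (nbhs x)) => i.
have E (y : 'V) : submxrow y p 0 i = y 0 (tagnat.Rank p i) by rewrite mxE.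
rewrite E (_ : (fun y : 'V => _) = fun y => y 0 (tagnat.Rank p i)).
  exact: (@coord_continuous R 1 _ 0 (tagnat.Rank p i) x).
by apply/funext => y; exact: E.
Qed.

Lemma submxrow_comb p (a b : R) x y :
  submxrow (a *: x + b *: y) p = a *: submxrow x p + b *: submxrow y p.
Proof. by apply/rowP => i; rewrite !mxE. Qed.

Lemma submxrow_deviate x p (y : 'rV[R]_(n_ p)) : submxrow (deviate x y) p = y.
Proof. rewrite /deviate mxrowK; exact: (dfwith_in (submxrow x) y). Qed.

Lemma submxrow_deviate_neq x p (y : 'rV[R]_(n_ p)) q : q != p ->
  submxrow (deviate x y) q = submxrow x q.
Proof.
move=> qp; rewrite /deviate mxrowK; apply: (dfwith_out (submxrow x) y).
by rewrite eq_sym.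
Qed.

Lemma deviate_id x p : deviate x (submxrow x p) = x.
Proof.
apply/mxrowP => q; have [->|qp] := eqVneq q p.
  by rewrite submxrow_deviate.
by rewrite submxrow_deviate_neq.
Qed.

Lemma sum_deviate (f : forall p, 'rV[R]_(n_ p) -> R) x p
    (y : 'rV[R]_(n_ p)) :
  \sum_q f q (submxrow (deviate x y) q) =
  \sum_q f q (submxrow x q) - f p (submxrow x p) + f p y.
Proof.
rewrite (bigD1 p)//= [in RHS](bigD1 p)//= submxrow_deviate.
rewrite (eq_bigr (fun q => f q (submxrow x q))) => [|q qp]; first ring.
by rewrite submxrow_deviate_neq.
Qed.

Lemma dot_deviate z x p (y : 'rV[R]_(n_ p)) :
  dot z (deviate x y) = dot z x + dot (submxrow z p) (y - submxrow x p).
Proof.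
rewrite !(dot_blocks z) (sum_deviate (fun q => dot (submxrow z q))).
by rewrite dotDr dotNr; ring.
Qed.

Lemma is_derive_block_coord (z : R -> 'V) (dz : 'V) t :
  (forall p, is_derive t (1 : R) (fun s => submxrow (z s) p) (submxrow dz p)) ->
  forall i, is_derive t (1 : R) (fun s => z s 0 i) (dz 0 i).
Proof.
move=> zp i; have [dz1 dz2] := zp (tagnat.sig1 i).
have E (v : 'V) : v 0 i = submxrow v (tagnat.sig1 i) 0 (tagnat.sig2 i).
  by rewrite mxE tagnat.sig2K.
rewrite [X in is_derive _ _ X](_ : _ = fun s =>
    submxrow (z s) (tagnat.sig1 i) 0 (tagnat.sig2 i)); last first.
  by apply/funext => s; exact: E.
apply: DeriveDef; first by move/derivable_mxP : dz1.
by rewrite E -dz2 derive_mx// mxE.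
Qed.

End Blocks.

(** * The game as a one-player problem *)

Section GameRegularizer.
Context {R : realType} {N : nat} {n_ : 'I_N -> nat}.
Variables (G : game R N n_) (theta : forall p : 'I_N, 'rV[R]_(n_ p) -> \bar R).
Variables (rho eps : R).
Arguments theta p _ : clear implicits.
Hypothesis actions_closed : forall p, closed (actions G p).
Hypothesis actions_convex : forall p, convex_region (actions G p).
Hypotheses (rho_gt0 : 0 < rho) (eps_gt0 : 0 < eps).
Hypothesis theta_closed : forall p, closed_function (theta p).
Hypothesis theta_proper : forall p, proper_function (theta p).
Hypothesis theta_dom : forall p, edom (theta p) = actions G p.
Hypothesis theta_strong : forall p, strongly_convex rho (theta p).

Definition player_cost p y : R := eps * fine (theta p y).

Definition total_cost (x : 'rV[R]_(\sum_p n_ p)) : R :=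
  \sum_p player_cost (submxrow x p).

Lemma theta_fin p y : actions G p y -> theta p y \is a fin_num.
Proof.
move=> Ay; rewrite fin_numE; have [/(_ y) h _] := theta_proper p.
move: Ay; rewrite -theta_dom /edom/= => h'.
by rewrite gt_eqF// lt_eqF.
Qed.

Lemma psi_fin p y : actions G p y -> psi eps theta y = (player_cost y)%:E.
Proof. by move=> Ay; rewrite /psi -{1}(fineK (theta_fin Ay)) EFinM. Qed.

Lemma profiles_neq0 : profiles G !=set0.
Proof.
have ne p : exists y, actions G p y.
  by have [_ [y]] := theta_proper p; rewrite theta_dom; exists y.
by exists (\mxrow_p sval (cid (ne p))) => p; rewrite mxrowK; exact: svalP.
Qed.

Lemma player_cost_lsc p : lsc_over (actions G p) (@player_cost p).
Proof.
move=> y c Ay cy.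
have cl : closed [set y' | (theta p y' <= (c / eps)%:E)%E].
  apply: (@closed_comp _ _ (fun y' => (y', c / eps)) (epigraph (theta p))).
    move=> y' _.
    have id_y' : (fun w : 'rV[R]_(n_ p) => w) @ nbhs y' --> nbhs y'.
      exact: cvg_id.
    have cst_c := @cvg_cst R (c / eps) _ (nbhs y') (nbhs_filter y').
    exact: (@cvg_pair _ _ _ (nbhs y') _ _ _ _ _ _ _ id_y' cst_c).
  exact: theta_closed.
have ny : (~` [set y' | (theta p y' <= (c / eps)%:E)%E]) y.
  move=> /=; rewrite -(fineK (theta_fin Ay)) lee_fin => h.
  by move: cy; rewrite /player_cost ltNge -ler_pdivlMl// mulrC h.
have := open_nbhs_nbhs (conj (closed_openC cl) ny).
apply: filterS => y' /= h Ay'; rewrite ltNge; apply/negP => h'; apply: h.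
by rewrite -(fineK (theta_fin Ay')) lee_fin ler_pdivlMr// mulrC.
Qed.

(** Players' regularizers add up to one regularizer on the set of profiles, so
that a profile can be treated as the action of a single player. *)
Lemma total_cost_regularizer : regularizer (profiles G) (eps * rho) total_cost.
Proof.
split.
- move=> x y t Ax Ay t01 p; rewrite submxrow_comb; exact: actions_convex.
- have -> : profiles G = \bigcap_p [set x | actions G p (submxrow x p)].
    by apply/seteqP; split=> x Ax p; [move=> _|]; exact: Ax.
  apply: closed_bigI => p _.
  apply: (@closed_comp _ _ (fun x => submxrow x p) (actions G p)) => //.
  by move=> x _; exact: submxrow_continuous.
- move=> x c Ax cx.
  (* The slack is divided by N + 1 so that N losses of e do not use it up. *)
  pose e := (total_cost x - c) / N.+1%:R.
  have e0 : 0 < e by rewrite divr_gt0// subr_gt0.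
  have Ne : N%:R * e < total_cost x - c.
    have -> : total_cost x - c = N.+1%:R * e.
      by rewrite /e mulrC divfK// pnatr_eq0.
    by rewrite ltr_pM2r// ltr_nat.
  have near_p p : \forall y \near x, actions G p (submxrow y p) ->
      player_cost (submxrow x p) - e < player_cost (submxrow y p).
    have lsc := @player_cost_lsc p (submxrow x p)
      (player_cost (submxrow x p) - e) (Ax p).
    have := lsc (_ : _ < _); rewrite ltrBlDr ltrDl => /(_ e0).
    exact: submxrow_continuous.
  have nx := @filter_forall _ _ _ (nbhs x) (nbhs_filter x) near_p.
  apply: (@filterS _ (nbhs x) _ _ _ _ nx) => y h Ay.
  have : total_cost x - N%:R * e <= total_cost y.
    have -> : N%:R * e = \sum_(p < N) e.
      by rewrite sumr_const card_ord mulr_natl.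
    by rewrite -sumrB; apply: ler_sum => p _; apply: ltW; exact: h.
  lra.
- move=> x y t Ax Ay t01; rewrite dot_blocks /total_cost !mulr_sumr.
  rewrite -big_split -sumrB; apply: ler_sum => p _ /=.
  have := theta_strong (submxrow x p) (submxrow y p) t01.
  have Axy : actions G p (t *: submxrow x p + (1 - t) *: submxrow y p).
    exact: actions_convex.
  rewrite -(fineK (theta_fin Axy)) -(fineK (theta_fin (Ax p))).
  rewrite -(fineK (theta_fin (Ay p))).
  rewrite -!EFinM -!EFinD lee_fin norm2_sq => h.
  rewrite /player_cost submxrow_comb submxrowB.
  by move: h; rewrite -(ler_pM2l eps_gt0); lra.
Qed.

Lemma subgradient_block z x p y :
  subgradient_over (profiles G) total_cost z x ->
  actions G p y ->
  player_cost (submxrow x p) + dot (submxrow z p) (y - submxrow x p)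
    <= player_cost y.
Proof.
move=> [Ax zx] Ay.
have Adev : profiles G (deviate x y).
  move=> q; have [qp|qp] := eqVneq q p.
    by subst q; rewrite submxrow_deviate.
  by rewrite submxrow_deviate_neq.
have := zx _ Adev; rewrite dotDr dotNr dot_deviate.
rewrite /total_cost (sum_deviate player_cost); lra.
Qed.

(** A solution x of the variational inequality with constant operator z
maximizes each player's objective.  Conversely, replacing one block of x by any
maximizer of that player's objective gives another solution; by uniqueness it
is x, so the maximizer picked by mirror_map is the block of x. *)
Lemma Cmap_subgradient z :
  subgradient_over (profiles G) total_cost z (Cmap eps theta G z).
Proof.
have reg := total_cost_regularizer.
have sigma_gt0 : 0 < eps * rho by rewrite mulr_gt0.
have hyp0 : hypomonotone_over (profiles G) 0 (fun=> z).
  by move=> x y _ _; rewrite subrr dot0l mul0r.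
have [] := variational_inequality_solvable reg profiles_neq0 (lexx 0)
  sigma_gt0 hyp0.
  apply: continuous_subspaceT => x.
  exact: (@cvg_cst _ z _ (nbhs x) (nbhs_filter x)).
move=> x xP; have [Ax _] := xP.
suff -> : Cmap eps theta G z = x by [].
apply/mxrowP => p; rewrite mxrowK.
set obj := fun y => ((dot y (submxrow z p))%:E - psi eps theta y)%E.
have objE y : actions G p y ->
    obj y = (dot y (submxrow z p) - player_cost y)%:E.
  by move=> Ay; rewrite /obj psi_fin// EFinB.
have xp_max : argmax (actions G p) obj (submxrow x p).
  split=> // y Ay; rewrite !objE// lee_fin.
  have := subgradient_block xP Ay.
  by rewrite dotDr dotNr !(dotC (submxrow z p)); lra.
have : argmax (actions G p) obj
    (mirror_map (actions G p) (@psi R N n_ eps theta p) (submxrow z p)).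
  by apply: xgetPex; exists (submxrow x p).
set y := mirror_map _ _ _; move=> [Ay /(_ _ (Ax p))].
rewrite !objE// lee_fin => ymax.
have devP : subgradient_over (profiles G) total_cost z (deviate x y).
  split=> [q|w Aw].
    have [qp|qp] := eqVneq q p; first by subst q; rewrite submxrow_deviate.
    by rewrite submxrow_deviate_neq.
  have := xP.2 w Aw; rewrite !dotDr !dotNr dot_deviate dotDr dotNr.
  rewrite /total_cost (sum_deviate player_cost) !(dotC (submxrow z p)); lra.
by rewrite -(subgradient_unique reg sigma_gt0 devP xP) submxrow_deviate.
Qed.

End GameRegularizer.

(** * Rest points and convergence of the dynamics *)

Section Assembly.
Context {R : realType} {N : nat} {n_ : 'I_N -> nat}.
Variables (G : game R N n_) (U : 'rV[R]_(\sum_p n_ p) -> 'rV[R]_(\sum_p n_ p)).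
Variables (theta : forall p : 'I_N, 'rV[R]_(n_ p) -> \bar R).
Variables (rho eps gamma : R).
Arguments theta p _ : clear implicits.
Hypotheses (G_concave : concave_game G) (U_grad : pseudo_gradient G U).
Hypothesis U_cont : {within profiles G, continuous U}.
Hypotheses (rho_gt0 : 0 < rho) (eps_gt0 : 0 < eps) (gamma_gt0 : 0 < gamma).
Hypothesis theta_closed : forall p, closed_function (theta p).
Hypothesis theta_proper : forall p, proper_function (theta p).
Hypothesis theta_dom : forall p, edom (theta p) = actions G p.
Hypothesis theta_strong : forall p, strongly_convex rho (theta p).

Let actions_closed p : closed (actions G p).
Proof. by have [[]] := G_concave p. Qed.

Let actions_convex p : convex_region (actions G p).
Proof. by have [[_ _ /convex_regionP]] := G_concave p. Qed.

Let CP := Cmap_subgradient actions_closed actions_convex rho_gt0 eps_gt0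
  theta_closed theta_proper theta_dom theta_strong.

(** Block p of zbar = U x is the gradient of the payoff of p at x and, as x is
the mirror image of zbar, a subgradient of the regularizer of p at x. *)
Lemma rest_point_perturbed_nash zbar : rest_points eps theta G U zbar ->
  perturbed_nash eps theta G (Cmap eps theta G zbar).
Proof.
move=> zE; have xP := CP zbar; have [Ax _] := xP.
rewrite /perturbed_nash; set x := Cmap eps theta G zbar in xP Ax *.
have zU : zbar = U x by exact: zE.
split=> // p y Ay; rewrite /perturbed_payoff submxrow_deviate.
rewrite (psi_fin _ theta_proper theta_dom Ay).
rewrite (psi_fin _ theta_proper theta_dom (Ax p)).
rewrite -!EFinB lee_fin.
have [_ [_ /(_ x)[] ]] := G_concave p; first by move=> q _; exact: Ax.
move=> /concave_functionP cpay _.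
have := concave_gradient_le (@actions_convex p) cpay (U_grad p Ax) (Ax p) Ay.
have := subgradient_block xP Ay.
by rewrite deviate_id zU; lra.
Qed.

Lemma dmd_converges_hypomonotone mu : 0 <= mu -> mu < eps * rho ->
  hypomonotone_over (profiles G) mu U -> dmd_converges eps theta G U gamma.
Proof.
move=> mu_ge0 mu_lt U_hypo z x u [_ [z_ode xu]].
have reg := total_cost_regularizer actions_closed actions_convex eps_gt0
  theta_closed theta_proper theta_dom theta_strong.
have xE t : 0 <= t -> x t = Cmap eps theta G (z t).
  by move=> t0; apply/mxrowP => p; rewrite mxrowK; have [-> _] := xu p t t0.
have uE t : 0 <= t -> u t = U (x t).
  by move=> t0; apply/mxrowP => p; have [_ ->] := xu p t t0.
have ode (t : R) i : 0 < t -> is_derive t (1 : R) (fun s => z s 0 i)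
    (gamma * (- z t 0 i + U (Cmap eps theta G (z t)) 0 i)).
  move=> t0; have := @is_derive_block_coord _ _ _ z
    (gamma *: (- z t + U (Cmap eps theta G (z t)))) t _ i.
  rewrite !mxE; apply=> p; have := z_ode p t t0.
  rewrite (uE t (ltW t0)) (xE t (ltW t0)).
  congr (is_derive _ _ _ _); apply/rowP => j; by rewrite !mxE.
have [zbar [zE z_cvg x_cvg]] := mirror_descent_converges reg
  (profiles_neq0 theta_proper theta_dom) mu_ge0 mu_lt gamma_gt0 U_hypo U_cont
  CP ode.
exists zbar; split=> //; last exact: rest_point_perturbed_nash.
apply: cvg_trans x_cvg; apply: near_eq_cvg.
by near=> t; rewrite xE//; near: t; apply: nbhs_pinfty_ge; exact: num_real.
Unshelve. all: by end_near. Qed.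

End Assembly.

Theorem theorem1 (R : realType) (N : nat) (n_ : 'I_N -> nat)
  (G : game R N n_)
  (U : 'rV[R]_(\sum_p n_ p) -> 'rV[R]_(\sum_p n_ p))
  (theta : forall p : 'I_N, 'rV[R]_(n_ p) -> \bar R)
  (rho eps gamma : R)
  (G_concave : concave_game G)
  (U_grad : pseudo_gradient G U)
  (U_cont : {within profiles G, continuous U})
  (G_coercive : forall p, ~ compact (actions G p) -> coercive_payoff G p)
  (rho_gt0 : 0 < rho)
  (theta_closed : forall p, closed_function (theta p))
  (theta_proper : forall p, proper_function (theta p))
  (theta_convex : forall p, econvex (theta p))
  (theta_dom : forall p, edom (theta p) = actions G p)
  (theta_strong : forall p, strongly_convex rho (theta p))
  (eps_gt0 : 0 < eps)
  (gamma_gt0 : 0 < gamma)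
  (rest_finite : finite_set (rest_points eps theta G U))
  (rest_isolated : forall z, rest_points eps theta G U z ->
     isolated (rest_points eps theta G U) z) :
  (monotone_on (profiles G) (fun x => - U x) \/
   strictly_monotone_on (profiles G) (fun x => - U x) \/
   (exists2 eta : R, 0 < eta &
      strongly_monotone_on (profiles G) eta (fun x => - U x)) ->
   dmd_converges eps theta G U gamma)
  /\
  (forall mu : R, 0 < mu ->
     hypo_monotone_on (profiles G) mu (fun x => - U x) ->
     mu * rho^-1 < eps ->
     dmd_converges eps theta G U gamma).
Proof.
have conv mu : 0 <= mu -> mu < eps * rho ->
    hypomonotone_over (profiles G) mu U -> dmd_converges eps theta G U gamma.
  exact: dmd_converges_hypomonotone.
have negE x x' : dot (- U x - - U x') (x - x') = - dot (U x - U x') (x - x').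
  by rewrite -opprD dotNl.
split=> [mono|mu mu_gt0 hypo mu_lt]; last first.
  apply: (conv mu) => [||x x' Ax Ax']; first exact: ltW.
    by rewrite -ltr_pdivrMr.
  by have := hypo x x' Ax Ax'; rewrite norm2_sq negE; lra.
apply: (conv 0) => [//||x x' Ax Ax']; first by rewrite mulr_gt0.
rewrite mul0r -oppr_ge0 -negE.
have [->|xx'] := eqVneq x x'; first by rewrite (subrr x') dot0r.
case: mono => [mono|[strict|[eta eta_gt0 strong]]]; first exact: mono.
  by apply: ltW; apply: strict => //; exact/eqP.
apply: le_trans (strong x x' Ax Ax').
by rewrite norm2_sq mulr_ge0 ?dotxx_ge0// ltW.
Qed.
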